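(* Let $\gamma\in(-\infty,0)\cup(0,1)$, $\hat\pi=\frac{\mu-r}{(1-\gamma)\sigma^2}$, and assume $0<\hat\pi<1$ and $\delta>0$. Let $b=b(\lambda_{01})>0$ be the solution of $$\frac{-\rho+\gamma r-\lambda_{01}}\gamma b+\frac{1-\gamma}\gamma b^{\frac\gamma{\gamma-1}}+\sup_{\pi\in[0,1]}\Bigl\{(\mu-r)\pi b+\frac{\gamma-1}2\sigma^2\pi^2b+\lambda_{01}\frac{\xi(\pi)}\gamma\Bigr\}=0$$ (so that $V(x)=b\,x^\gamma/\gamma$ is the liquid-regime value function described in the context) with $b\to\hat f$ as $\lambda_{01}\to 0$. Then, as $\lambda_{01}\to0$ with all other parameters fixed, $$b=\hat f+\lambda_{01}b_1+O(\lambda_{01}^2),\qquad b_1=\frac{(\xi(\hat\pi)-\hat f)(1-\gamma)}\delta,$$ and the efficiency loss $\mathbf\Theta^{(\gamma)}$, defined by $b\,\frac{x^\gamma}\gamma=\hat f\,\frac{((1-\mathbf\Theta^{(\gamma)})x)^\gamma}\gamma$, satisfies $$\mathbf\Theta^{(\gamma)}=\lambda_{01}\mathbf\Theta^{(\gamma)}_1+O(\lambda_{01}^2),\qquad\mathbf\Theta_1^{(\gamma)}=-\frac{b_1}{\gamma\hat f}=\Bigl(\frac{\xi(\hat\pi)}{\hat f}-1\Bigr)\frac{\gamma-1}{\gamma\delta}.$$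
   Context: Parameters: $\lambda_{01},\lambda_{10}>0$, $\rho>0$, $r\ge0$, $\mu\in\mathbb R$, $\sigma>0$, $L\in[0,1)$. Put $\theta=\frac{\mu-r}\sigma$, $\delta=\rho-\gamma r-\frac{\theta^2\gamma}{2(1-\gamma)}$, $\hat f=\bigl(\frac{1-\gamma}\delta\bigr)^{1-\gamma}$; $\hat V(x)=\hat f x^\gamma/\gamma$ is the classical infinite-horizon Merton value function for utility $u(c)=c^\gamma/\gamma$ and discount rate $\rho$. A liquidity shock arrives at rate $\lambda_{01}$, makes the stock drop by the fraction $L$, and ends at rate $\lambda_{10}$; during it there is no trading, the stock grows at rate $r$, and consumption is paid from cash only; after it the agent faces the Merton problem. The value function during the shock, with a fraction $\pi$ of wealth in stock, is $W(\pi,x)=f(\pi)x^\gamma/\gamma$, where $f$ on $[0,1)$ solves $$(-\rho+\gamma r)f+(1-\gamma)\bigl[f-\pi\gamma^{-1}f'\bigr]^{\frac\gamma{\gamma-1}}+\lambda_{10}[\hat f-f]=0$$ with $\lim_{\pi\uparrow1}f(\pi)=+\infty$ if $\gamma<0$, and $f(1)=\frac{\lambda_{10}\hat f}{\rho-\gamma r+\lambda_{10}}$ if $\gamma>0$. Finally $\xi(\pi)=f\bigl(\frac{\pi(1-L)}{1-\pi L}\bigr)(1-\pi L)^\gamma$. The liquid-regime value function (before the shock) is $V(x)=b\,x^\gamma/\gamma$. *)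

(* Defs.v *)
From mathcomp Require Import all_boot all_order all_algebra.
From mathcomp Require Import all_classical all_reals all_analysis.

Set Implicit Arguments.
Unset Strict Implicit.
Unset Printing Implicit Defensive.

Import Order.TTheory GRing.Theory Num.Theory.
Import numFieldNormedType.Exports.

Local Open Scope classical_set_scope.
Local Open Scope ring_scope.

Section Definitions.
Context {R : realType}.
Implicit Types (f : R -> R) (p : R).

Section Merton.
Variables (rho r mu sigma gamma : R).

Definition merton_theta : R := (mu - r) / sigma.

Definition merton_delta : R :=
  rho - gamma * r - merton_theta ^+ 2 * gamma / (2 * (1 - gamma)).

Definition merton_fhat : R := ((1 - gamma) / merton_delta) `^ (1 - gamma).

Definition merton_pihat : R := (mu - r) / ((1 - gamma) * sigma ^+ 2).

End Merton.

Section Shock.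
Variables (rho r gamma lambda10 fhat : R).

(* [f p - p / gamma * df] is raised to a noninteger real power, so being a
   solution includes its positivity ([`^] has a default value on negative
   bases). *)
Definition shock_ode f (df : R) p : Prop :=
  let g := f p - p * gamma^-1 * df in
  0 < g /\
  (- rho + gamma * r) * f p + (1 - gamma) * g `^ (gamma / (gamma - 1))
    + lambda10 * (fhat - f p) = 0.

(* [f] matters on [0, 1) only if [gamma < 0], on [0, 1] otherwise; its
   derivative at 0 is one-sided. *)
Definition shock_solution f : Prop :=
  exists df : R -> R,
    [/\ forall p, 0 < p < 1 -> is_derive p 1 f (df p),
        (f p - f 0) / p @[p --> 0^'+] --> df 0,
        forall p, 0 <= p < 1 -> shock_ode f (df p) p,
        gamma < 0 -> f p @[p --> 1^'-] --> +oo
      & 0 < gamma ->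
          f 1 = lambda10 * fhat / (rho - gamma * r + lambda10) /\
          f p @[p --> 1^'-] --> f 1].

End Shock.

Definition shock_xi (gamma L : R) f p : R :=
  f (p * (1 - L) / (1 - p * L)) * (1 - p * L) `^ gamma.

(* The boundary value f(1) = +oo for [gamma < 0] gives xi(1) = +oo: when all
   wealth is in the stock, it equals f(1) * (1 - L)^gamma. *)
Definition shock_xi_ext (gamma L : R) f p : \bar R :=
  if (gamma < 0) && (p == 1) then +oo%E else (shock_xi gamma L f p)%:E.

Definition hjb_sup (r mu sigma gamma L : R) f (lambda01 b : R) : \bar R :=
  ereal_sup [set
    (((mu - r) * p * b + (gamma - 1) / 2 * sigma ^+ 2 * p ^+ 2 * b)%:E
       + lambda01%:E * (shock_xi_ext gamma L f p * (gamma^-1)%:E))%E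
    | p in `[0, 1]%classic].

Definition liquid_hjb (rho r mu sigma gamma L : R) f (lambda01 b : R) : Prop :=
  (((- rho + gamma * r - lambda01) / gamma * b
     + (1 - gamma) / gamma * b `^ (gamma / (gamma - 1)))%:E
   + hjb_sup r mu sigma gamma L f lambda01 b = 0)%E.

(* The condition [Theta < 1] keeps the base of the power positive. *)
Definition is_efficiency_loss (gamma fhat b Theta : R) : Prop :=
  Theta < 1 /\
  forall x : R, 0 < x ->
    b * (x `^ gamma / gamma) = fhat * (((1 - Theta) * x) `^ gamma / gamma).

End Definitions.

(* Main.v *)
Require Import Defs.
From mathcomp Require Import all_boot all_order all_algebra.
From mathcomp Require Import all_classical all_reals all_analysis.
From mathcomp Require Import ring lra.
Import Order.TTheory GRing.Theory Num.Theory.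
Import numFieldNormedType.Exports.
Local Open Scope classical_set_scope.
Local Open Scope ring_scope.

(** The Merton part of the supremum is [k b (pihat p - p^2/2)] with
    [k = (1 - gamma) sigma^2], strictly concave with maximiser [pihat]. Since
    [xi / gamma] is differentiable at [pihat] and bounded above on [0, 1], it is
    at most [xi(pihat) / gamma + C |p - pihat|] everywhere, and completing the
    square shows that the supremum exceeds its value at [p = pihat] by at most
    [(l C)^2 / (2 k b)].
    With [q = gamma / (gamma - 1)] the equation for [b] becomes
    [(1 - gamma) b^q - delta b + l (xi(pihat) - b) = O(l^2)].
    The function [(1 - gamma) b^q - delta b] vanishes at [fhat] with derivative
    [- delta / (1 - gamma)], which gives first [b - fhat = O(l)] and then the
    expansion. The loss is [1 - (b / fhat)^(1 / gamma)]. *)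

(** * Taylor remainders, compactness and a perturbed linear equation *)

Section Expansions.
Context {R : realType}.
Implicit Types (f df g : R -> R) (x a : R).

Lemma is_derive1_lipschitz f x a : is_derive x 1 f a ->
  exists2 K : R, 0 <= K & \forall z \near x, `|f z - f x| <= K * `|z - x|.
Proof.
move=> /is_derive1_caratheodory[g [fE cg gx]].
exists (`|g x| + 1); first by rewrite addr_ge0.
have : `|g z| @[z --> x] --> `|g x| by apply: cvg_norm; exact: cg.
move=> /cvgr_le /(_ (`|g x| + 1)); rewrite ltrDl ltr01 => /(_ isT) h.
near=> z; rewrite fE normrM ler_wpM2r//.
by near: z.
Unshelve. all: by end_near. Qed.

(** By the mean value theorem the increment is [df c * (z - x)] with [c] no farther from [x] than
    [z], and [df] is Lipschitz at [x] because it is differentiable there. Continuity of a second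
    derivative is never invoked. *)
Lemma is_derive1_taylor2 f df x a :
  (\forall z \near x, is_derive (z : R) (1 : R) f (df z)) ->
  is_derive x 1 df a ->
  exists2 K : R, 0 <= K &
    \forall z \near x, `|f z - f x - df x * (z - x)| <= K * (z - x) ^+ 2.
Proof.
move=> fdf /is_derive1_lipschitz[K K0 dfK]; exists K => //.
have [e /= e0 eP] : exists2 e : R, 0 < e & forall z, `|z - x| < e ->
    is_derive z (1 : R) f (df z) /\ `|df z - df x| <= K * `|z - x|.
  have [e e0 h] := filterI fdf dfK; exists e => // z zx; apply: h.
  by rewrite /ball_/= distrC.
suff h z : `|z - x| < e -> exists2 c, `|c - x| <= `|z - x| &
    f z - f x = df c * (z - x).
  near=> z; have zx : `|z - x| < e.
    by near: z; exists e => //= z; rewrite /ball_ /= distrC.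
  have [c cz ->] := h z zx.
  rewrite -mulrBl normrM -(real_normK (num_real (z - x))) expr2 mulrA.
  rewrite ler_wpM2r//; have [_ /le_trans] := eP c (le_lt_trans cz zx).
  by apply; rewrite ler_wpM2l.
move=> zx; have cf (u v : R) : (forall t, t \in `[u, v] -> `|t - x| < e) ->
    {within `[u, v], continuous f}.
  move=> uv; apply: derivable_within_continuous => t /uv /eP[dt _].
  exact: (@ex_derive _ _ _ _ _ _ _ dt).
have [xz|zltx] := leP x z.
  have near_x t : t \in `[x, z] -> `|t - x| <= `|z - x|.
    by rewrite in_itv/= => /andP[xt tz]; rewrite !ger0_norm ?subr_ge0// lerB.
  have near_e t : t \in `[x, z] -> `|t - x| < e.
    by move=> /near_x /le_lt_trans; apply.
  have df_z t : t \in `]x, z[ -> is_derive t 1 f (df t).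
    by move=> /subset_itv_oo_cc /near_e /eP[].
  have [c /near_x cz ->] := MVT_segment xz df_z (cf _ _ near_e).
  by exists c.
have near_x t : t \in `[z, x] -> `|t - x| <= `|z - x|.
  rewrite in_itv/= => /andP[zt tx].
  by rewrite !ler0_norm ?subr_le0 ?(ltW zltx)// lerN2 lerB.
have near_e t : t \in `[z, x] -> `|t - x| < e.
  by move=> /near_x /le_lt_trans; apply.
have df_z t : t \in `]z, x[ -> is_derive t 1 f (df t).
  by move=> /subset_itv_oo_cc /near_e /eP[].
have [c /near_x cz fE] := MVT_segment (ltW zltx) df_z (cf _ _ near_e).
by exists c => //; rewrite -opprB fE -mulrN opprB.
Unshelve. all: by end_near. Qed.

Lemma powR_taylor2 x a : 0 < x -> exists2 K : R, 0 <= K &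
  \forall z \near x,
    `|z `^ a - x `^ a - a * x `^ (a - 1) * (z - x)| <= K * (z - x) ^+ 2.
Proof.
move=> x0; apply: (@is_derive1_taylor2 (@powR R ^~ a)
    (fun z => a * z `^ (a - 1)) x (a * ((a - 1) * x `^ (a - 1 - 1)))).
  near=> z; apply: is_derive1_powR; near: z; exact: lt_nbhsr.
by apply: is_deriveZ; exact: is_derive1_powR.
Unshelve. all: by end_near. Qed.

(** One-sided on purpose: for [gamma < 0] the function [f / gamma] tends to -oo at 1, so only upper
    bounds can hold. *)
Lemma locally_bounded_above g (A : set R) : compact A ->
  (forall x, A x -> exists M : R, \forall z \near x, A z -> g z <= M) ->
  exists M : R, forall x, A x -> g x <= M.
Proof.
move=> /compact_near_coveringP cA gA.
have [M [_ MP]] : \forall M \near +oo, A `<=` (fun z => A z -> g z <= M).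
  apply: cA => x /gA[M gM].
  exists ([set z | A z -> g z <= M], [set N | M <= N]) => /=.
    by split=> //; apply: nbhs_pinfty_ge; rewrite num_real.
  by move=> [z N] /= [zM MN] Az; apply: le_trans (zM Az) MN.
(* The filter at +oo speaks of bounds strictly above [M]. *)
exists (M + 1) => x Ax; apply: (MP (M + 1)) => //.
by rewrite ltrDl.
Qed.

(** A bootstrap in two passes: [e --> 0] first yields [e = O(l)], which then makes the right-hand
    side [O(l^2)]. *)
Lemma implicit_expansion (e : R -> R) (m s K : R) : 0 < m -> 0 <= K ->
  e l @[l --> 0^'+] --> 0 ->
  (\forall l \near 0^'+,
    `|l * s - m * e l| <= K * (e l ^+ 2 + l * `|e l| + l ^+ 2)) ->
  exists C : R, \forall l \near 0^'+, `|e l - l * (s / m)| <= C * l ^+ 2.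
Proof.
move=> m0 K0 e0 eq.
(* Once [K |e| <= m/4] and [K l <= m/4], the terms in [e] on the right are
   absorbed by [m |e|], whence [|e| <= C l]. *)
pose C := 2 * (`|s| + K) / m.
pose d := m / (4 * (K + 1)).
have d0 : 0 < d by rewrite divr_gt0// mulr_gt0// ltr_wpDl.
exists (K * (C ^+ 2 + C + 1) / m).
near=> l.
have l0 : 0 < l by near: l; exact: nbhs_right_gt.
have l1 : l < 1 by near: l; apply: nbhs_right_lt.
have ld : l < d by near: l; apply: nbhs_right_lt.
have ed : `|e l| < d.
  by near: l; move/cvgr0Pnorm_lt : e0; apply.
have Kd : K * d <= m / 4.
  rewrite /d; have -> : K * (m / (4 * (K + 1))) = (m / 4) * (K / (K + 1)).
    by field; apply/lt0r_neq0/ltr_wpDl.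
  by rewrite ler_piMr ?divr_ge0 ?(ltW m0)// ler_pdivrMr ?ltr_wpDl// mul1r lerDl.
have eql : `|l * s - m * e l| <= K * (e l ^+ 2 + l * `|e l| + l ^+ 2).
  by near: l.
(* First pass: [m |e| <= (m/2) |e| + (|s| + K) l], whence the factor 2 in [C]. *)
have eC : `|e l| <= C * l.
  have h1 : m * `|e l| <= `|l * s - m * e l| + l * `|s|.
    have := ler_normB (l * s) (l * s - m * e l).
    by rewrite subKr addrC !normrM (gtr0_norm m0) (gtr0_norm l0).
  have h2 : K * `|e l| ^+ 2 <= m / 4 * `|e l|.
    rewrite expr2 mulrA ler_wpM2r// (le_trans _ Kd)// ler_wpM2l//.
    exact: ltW.
  have h3 : K * (l * `|e l|) <= m / 4 * `|e l|.
    rewrite mulrA ler_wpM2r// (le_trans _ Kd)// ler_wpM2l//.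
    exact: ltW.
  have h4 : K * l ^+ 2 <= K * l by rewrite ler_wpM2l// expr2 ler_piMl// ltW.
  rewrite (real_normK (num_real _)) in h2.
  rewrite /C mulrAC ler_pdivlMr//; lra.
(* Second pass: with [|e| <= C l] the right-hand side is at most [K (C^2 + C + 1) l^2]. *)
have -> : e l - l * (s / m) = - ((l * s - m * e l) / m).
  by field; exact: lt0r_neq0.
rewrite normrN normrM normfV (gtr0_norm m0) mulrAC ler_pM2r ?invr_gt0//.
apply: (le_trans eql); rewrite -mulrA ler_wpM2l//.
rewrite -(real_normK (num_real (e l))).
have h5 : `|e l| ^+ 2 <= (C * l) ^+ 2.
  by rewrite lerXn2r// nnegrE (le_trans _ eC).
have h6 : l * `|e l| <= l * (C * l) by rewrite ler_wpM2l// ltW.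
nra.
Unshelve. all: by end_near. Qed.
End Expansions.

(** * Upper bounds and regularity of the shock value and of [xi] *)

Section ShockSolution.
Context {R : realType}.
Variables (rho r gamma lambda10 fhat L : R) (f : R -> R).
Hypotheses (gamma0 : gamma != 0) (L01 : 0 <= L < 1).
Hypothesis hf : shock_solution rho r gamma lambda10 fhat f.

(** Local upper bounds come from the one-sided derivative at 0, differentiability inside, and the
    boundary condition at 1; compactness of [0, 1] glues them. *)
Lemma shock_solution_bounded : exists M : R, forall p : R, 0 <= p <= 1 ->
  f p / gamma <= M.
Proof.
have [df [fdf df0 _ fNy fy]] := hf.
have [] := @locally_bounded_above R (fun p => f p / gamma) `[0, 1]%classic.
- exact: segment_compact.
- move=> x /=; rewrite in_itv/= => /andP[x0 x1].
  have [->|x_neq0] := eqVneq x 0.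
    (* A bounded difference quotient gives [|f z - f 0| <= (|df 0| + 1) z], and [z <= 1]. The right
       neighbourhood omits 0 itself, hence the case split on [z]. *)
    exists ((`|f 0| + (`|df 0| + 1)) / `|gamma|).
    have : `|(f p - f 0) / p| @[p --> 0^'+] --> `|df 0| by exact: cvg_norm.
    move=> /cvgr_le /(_ (`|df 0| + 1)); rewrite ltrDl ltr01 => /(_ isT).
    rewrite near_withinE; apply: filterS => z zP.
    rewrite in_itv/= => /andP[z0 z1].
    rewrite (le_trans (ler_norm _))// normf_div ler_wpM2r ?invr_ge0//.
    move: z0; rewrite le_eqVlt => /predU1P[<-|z0].
      by rewrite lerDl addr_ge0.
    rewrite -{1}(subrKC (f 0) (f z)) (le_trans (ler_normD _ _))// lerD2l.
    have := zP z0; rewrite normf_div (gtr0_norm z0) ler_pdivrMr// => /le_trans.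
    by apply; rewrite ler_piMr// addr_ge0.
  have {x_neq0} x_gt0 : 0 < x by rewrite lt0r x_neq0.
  have [->{x x0 x1 x_gt0}|x_neq1] := eqVneq x 1.
    (* If [gamma < 0], [f 1] is an arbitrary value unrelated to the limit. *)
    move: gamma0; rewrite neq_lt => /orP[gN|gP].
      exists (`|f 1 / gamma|).
      have := fNy gN; move=> /cvgryPge /(_ 0).
      rewrite near_withinE; apply: filterS => z zP.
      rewrite in_itv/= => /andP[z0].
      rewrite le_eqVlt => /predU1P[->|z1]; first exact: ler_norm.
      by rewrite (le_trans _ (normr_ge0 _))// mulr_ge0_le0 ?zP// invr_le0 ltW.
    have [_ fcvg] := fy gP; exists ((`|f 1| + 1) / gamma).
    move/cvg_norm : fcvg => /cvgr_le /(_ (`|f 1| + 1)).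
    rewrite ltrDl ltr01 => /(_ isT).
    rewrite near_withinE; apply: filterS => z zP.
    rewrite in_itv/= => /andP[z0 z1].
    rewrite ler_pM2r ?invr_gt0// (le_trans (ler_norm _))//.
    move: z1; rewrite le_eqVlt => /predU1P[->|/zP//].
    by rewrite lerDl.
  have x_lt1 : x < 1 by rewrite lt_neqAle x_neq1.
  have [|K K0 fK] := @is_derive1_lipschitz _ f x (df x).
    by apply: fdf; rewrite x_gt0.
  exists ((`|f x| + K) / `|gamma|).
  have near1 : \forall z \near x, `|z - x| < 1.
    by exists 1 => //= z; rewrite /ball_/= distrC.
  near=> z => _.
  rewrite (le_trans (ler_norm _))// normf_div ler_wpM2r ?invr_ge0//.
  rewrite -{1}(subrKC (f x) (f z)) (le_trans (ler_normD _ _))// lerD2l.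
  apply: (@le_trans _ _ (K * `|z - x|)); first by near: z.
  by rewrite ler_piMr// ltW//; near: z.
- by move=> M MP; exists M => p p01; apply: MP; rewrite /= in_itv.
Unshelve. all: by end_near. Qed.

Let one_sub_pL (p : R) : 0 <= p <= 1 -> 1 - L <= 1 - p * L <= 1.
Proof. by case/andP: L01 => L0 L1 /andP[p0 p1]; nra. Qed.

(** This quotient is the share of wealth in stock just after the drop. *)
Let share_bounds (p : R) : 0 <= p <= 1 -> 0 <= p * (1 - L) / (1 - p * L) <= 1.
Proof.
move=> p01; have /andP[pL _] := one_sub_pL p p01.
case/andP: L01 p01 => L0 L1 /andP[p0 p1].
have w0 : 0 < 1 - p * L by apply: lt_le_trans pL; rewrite subr_gt0.
apply/andP; split; last by rewrite ler_pdivrMr//; nra.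
by rewrite divr_ge0 ?(ltW w0)// mulr_ge0// subr_ge0 ltW.
Qed.

Lemma shock_xi_bounded : exists M : R, forall p : R, 0 <= p <= 1 ->
  shock_xi gamma L f p / gamma <= M.
Proof.
have [M fM] := shock_solution_bounded.
(* The power of [1 - p L] is at most [(1 - L)^gamma] if [gamma < 0] and at most 1 if [gamma > 0];
   the sum covers both signs. Truncating [M] at 0 makes multiplication by this factor monotone. *)
exists (Num.max M 0 * (1 + (1 - L) `^ gamma)) => p p01.
have /andP[wL w1] := one_sub_pL p p01.
have L0 : 0 < 1 - L by case/andP: L01; rewrite subr_gt0.
have w0 := lt_le_trans L0 wL.
rewrite /shock_xi mulrAC.
apply: (@le_trans _ _ (Num.max M 0 * (1 - p * L) `^ gamma)).
  by rewrite ler_wpM2r ?powR_ge0// le_max fM ?share_bounds.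
rewrite ler_wpM2l ?le_max ?lexx ?orbT//.
move: gamma0; rewrite neq_lt => /orP[gN|gP].
  have gN0 : 0 <= - gamma by rewrite oppr_ge0 ltW.
  rewrite (le_trans _ (_ : (1 - L) `^ gamma <= _)) ?lerDr//.
  rewrite -(opprK gamma) 2!(powRN _ (- gamma)) lef_pV2 ?posrE ?powR_gt0//.
  by rewrite ge0_ler_powR ?nnegrE ?(ltW w0) ?(ltW L0).
apply: (@le_trans _ _ (1 `^ gamma)); last by rewrite powR1 lerDl powR_ge0.
by rewrite ge0_ler_powR ?nnegrE ?(ltW w0) ?(ltW gP).
Qed.

Lemma shock_xi_derivable (p : R) :
  0 < p < 1 -> derivable (shock_xi gamma L f) p 1.
Proof.
case/andP: L01 => L0 L1 /andP[p0 p1].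
have w0 : 0 < 1 - p * L by nra.
have [df [fdf _ _ _ _]] := hf.
have dw : derivable (fun q : R => 1 - q * L) p 1 by [].
have dw1 : derivable (fun q : R => (1 - q * L)^-1) p 1.
  by apply: derivableV => //; exact: lt0r_neq0.
have dy : derivable (fun q : R => q * (1 - L) / (1 - q * L)) p 1.
  by apply: derivableM.
have /derivableP dy' := dy.
have fy : is_derive (p * (1 - L) / (1 - p * L)) 1 f
    (df (p * (1 - L) / (1 - p * L))).
  apply: fdf; apply/andP; split; last by rewrite ltr_pdivrMr//; nra.
  by rewrite divr_gt0// mulr_gt0// subr_gt0.
have /derivableP dw' := dw.
have h1 := @is_derive1_comp _ f (fun q : R => q * (1 - L) / (1 - q * L)) _ _ _
  fy dy'.
have h2 := @is_derive1_comp _ (@powR R ^~ gamma) (fun q : R => 1 - q * L) _ _ _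
  (@is_derive1_powR _ gamma _ w0) dw'.
exact: (@ex_derive _ _ _ _ _ _ _ (is_deriveM h1 h2)).
Qed.

(** Within distance [e] of [phat] the local Lipschitz constant serves; farther away
    [|p - phat| / e >= 1], so the global upper bound does. [C] adds the two slopes. *)
Lemma shock_xi_linear_bound (phat : R) : 0 < phat < 1 ->
  exists2 C : R, 0 <= C & forall p : R, 0 <= p <= 1 ->
    shock_xi gamma L f p / gamma <=
      shock_xi gamma L f phat / gamma + C * `|p - phat|.
Proof.
move=> /shock_xi_derivable /derivableP.
move=> /is_derive1_lipschitz[K K0 [e /= e0 xiK]].
have [M xiM] := shock_xi_bounded.
set xh := shock_xi gamma L f phat / gamma.
have Ce0 : 0 <= (`|M| + `|xh|) / e by rewrite divr_ge0 ?addr_ge0// ltW.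
exists (K / `|gamma| + (`|M| + `|xh|) / e).
  by rewrite addr_ge0// divr_ge0.
move=> p p01; rewrite mulrDl addrA.
have [pe|pe] := ltP `|p - phat| e.
  apply: (@le_trans _ _ (xh + K / `|gamma| * `|p - phat|)); last first.
    by rewrite lerDl mulr_ge0.
  rewrite -lerBlDl /xh -mulrBl (le_trans (ler_norm _))// normf_div mulrAC.
  by rewrite ler_wpM2r ?invr_ge0// xiK// /ball_/= distrC.
apply: (@le_trans _ _ (xh + (`|M| + `|xh|))); last first.
  apply: lerD; first by rewrite lerDl mulr_ge0 ?divr_ge0.
  by rewrite mulrAC ler_pdivlMr// ler_wpM2l// addr_ge0.
have := ler_norm M; have := ler_norm (- xh); rewrite normrN.
by move=> ? ?; apply: (le_trans (xiM _ p01)); lra.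
Qed.

End ShockSolution.

(** * The supremum over portfolios and the residual of the equation for [b] *)

Lemma hjb_sup_bounds {R : realType} (r mu sigma gamma L C l b : R)
    (f : R -> R) :
  let phat := merton_pihat r mu sigma gamma in
  let k := (1 - gamma) * sigma ^+ 2 in
  let main := k * phat ^+ 2 / 2 * b + l * (shock_xi gamma L f phat / gamma) in
  0 < sigma -> gamma < 1 -> 0 < phat < 1 -> 0 < l -> 0 < b ->
  (forall p : R, 0 <= p <= 1 -> shock_xi gamma L f p / gamma <=
      shock_xi gamma L f phat / gamma + C * `|p - phat|) ->
  (main%:E <= hjb_sup r mu sigma gamma L f l b
           <= (main + l ^+ 2 * C ^+ 2 / (2 * k * b))%:E)%E.
Proof.
move=> phat k main sigma0 gamma1 /andP[ph0 ph1] l0 b0 xiC.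
have k0 : 0 < k by rewrite mulr_gt0 ?subr_gt0// exprn_gt0.
have muE : mu - r = k * phat.
  by rewrite /phat /merton_pihat mulrC divfK// gt_eqF.
have quadE p : (mu - r) * p * b + (gamma - 1) / 2 * sigma ^+ 2 * p ^+ 2 * b =
    k * phat ^+ 2 / 2 * b - k * b / 2 * (p - phat) ^+ 2.
  by rewrite muE /k; field.
apply/andP; split.
  apply: ereal_sup_ubound; exists phat; first by rewrite /= in_itv/= !ltW.
  rewrite /shock_xi_ext (lt_eqF ph1) andbF quadE subrr expr0n mulr0 subr0.
  by rewrite -!EFinM.
apply: ge_ereal_sup => _ [p p01 <-]; rewrite /= in_itv/= in p01.
(* For [gamma < 0] and [p = 1], dividing [xi = +oo] by [gamma] gives -oo, so this point is
   harmless. *)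
rewrite quadE /shock_xi_ext; case: ifPn => [/andP[gN _]|_].
  by rewrite lt0_mulye ?lte_fin ?invr_lt0// gt0_muleNy ?lte_fin// addeNy leNye.
rewrite -!EFinM -EFinD lee_fin.
have := xiC p p01; rewrite -(ler_pM2l l0) => xip.
rewrite -lerBrDl; apply: (le_trans xip); rewrite /main.
set t := `|p - phat|; rewrite -(real_normK (num_real (p - phat))) -/t.
have kb : 0 < k * b by rewrite mulr_gt0.
(* The left side is the maximum over [t] of [l C t - k b t^2 / 2], attained at [t = l C / (k b)];
   the square is the deficit. *)
have -> : l ^+ 2 * C ^+ 2 / (2 * k * b) =
    (k * b * t - l * C) ^+ 2 / (2 * (k * b))
    + l * (C * t) - k * b / 2 * t ^+ 2.
  by field; rewrite !gt_eqF.
have : 0 <= (k * b * t - l * C) ^+ 2 / (2 * (k * b)).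
  by rewrite divr_ge0 ?sqr_ge0// mulr_ge0// ltW.
lra.
Qed.

(** Multiply the equation by [gamma]: since [k phat^2 = theta^2 / (1 - gamma)], the Merton maximum
    merges with [- rho + gamma r] into [- delta]. What is left is [- gamma] times the excess of the
    supremum over its value at [phat]. *)
Lemma liquid_hjb_residual {R : realType} (rho r mu sigma gamma L C l b : R)
    (f : R -> R) :
  let phat := merton_pihat r mu sigma gamma in
  let k := (1 - gamma) * sigma ^+ 2 in
  let delta := merton_delta rho r mu sigma gamma in
  0 < sigma -> gamma != 0 -> gamma < 1 -> 0 < phat < 1 -> 0 < l -> 0 < b ->
  (forall p : R, 0 <= p <= 1 -> shock_xi gamma L f p / gamma <=
      shock_xi gamma L f phat / gamma + C * `|p - phat|) ->
  liquid_hjb rho r mu sigma gamma L f l b ->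
  `|(1 - gamma) * b `^ (gamma / (gamma - 1)) - delta * b
     + l * (shock_xi gamma L f phat - b)| <=
  `|gamma| * (l ^+ 2 * C ^+ 2 / (2 * k * b)).
Proof.
move=> phat k delta sigma0 gamma0 gamma1 ph01 l0 b0 xiC.
have := @hjb_sup_bounds _ r mu sigma gamma L C l b f
  sigma0 gamma1 ph01 l0 b0 xiC.
(* Lying between two finite bounds, the supremum is a real [s]. *)
rewrite /liquid_hjb; case: hjb_sup => [s| |]//; rewrite !lee_fin.
set xh := shock_xi gamma L f _; set bq := b `^ _.
move=> /andP[sL sU] [] eq.
have -> : (1 - gamma) * bq - delta * b + l * (xh - b) =
    - gamma * (s - (k * phat ^+ 2 / 2 * b + l * (xh / gamma))).
  move/eqP: eq; rewrite addrC addr_eq0 => /eqP ->.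
  rewrite /k /phat /delta /merton_pihat /merton_delta /merton_theta.
  by field; rewrite gamma0 !gt_eqF ?subr_gt0// lt_eqF.
rewrite normrM normrN ler_wpM2l// ger0_norm ?subr_ge0//.
by rewrite lerBlDl.
Qed.

(** * Expansions of the liquid value and of the efficiency loss *)

Lemma bigO_sqr_at_right {R : realType} (f g : R -> R) (C : R) :
  (\forall l \near 0^'+, `|f l - g l| <= C * l ^+ 2) ->
  f = g +O_ (0^'+) (fun l : R => l ^+ 2).
Proof.
move=> fgC; apply/eqaddOP; near=> k.
have Ck : C <= k by near: k; apply: nbhs_pinfty_ge; rewrite num_real.
apply: filterS fgC => l /le_trans; apply.
by rewrite (ger0_norm (sqr_ge0 l)) ler_wpM2r ?sqr_ge0.
Unshelve. all: by end_near. Qed.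

(** Wealth [x = 1] already determines [Theta]; [Theta < 1] allows the power to be inverted. *)
Lemma efficiency_lossE {R : realType} (gamma fhat b Theta : R) :
  gamma != 0 -> 0 < fhat ->
  is_efficiency_loss gamma fhat b Theta ->
  Theta = 1 - (b / fhat) `^ gamma^-1.
Proof.
move=> gamma0 fhat0 [ltT1 /(_ 1 ltr01)].
rewrite powR1 mulr1 2!mulrA mulr1 => /(divIf gamma0) ->.
by rewrite mulrC mulKf ?gt_eqF// -powRrM divff// powRr1 ?subKr// subr_ge0 ltW.
Qed.

(** For [a = (1 - gamma) / delta] this evaluates [fhat^(q - 1)], the slope in the linearisation at
    [fhat]. *)
Lemma powR_dual_exponent {R : realType} (a gamma : R) : 0 < a -> gamma < 1 ->
  (a `^ (1 - gamma)) `^ (gamma / (gamma - 1) - 1) = a^-1.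
Proof.
move=> a0 gamma1; rewrite -powRrM.
have -> : (1 - gamma) * (gamma / (gamma - 1) - 1) = -1.
  by field; rewrite lt_eqF ?subr_lt0.
by rewrite powR_inv1// ltW.
Qed.

Lemma liquid_value_expansion {R : realType}
    (rho r mu sigma gamma lambda10 L : R) (f b : R -> R) :
  let fhat := merton_fhat rho r mu sigma gamma in
  let delta := merton_delta rho r mu sigma gamma in
  let xihat := shock_xi gamma L f (merton_pihat r mu sigma gamma) in
  0 < sigma -> 0 <= L < 1 -> gamma != 0 -> gamma < 1 ->
  0 < merton_pihat r mu sigma gamma < 1 -> 0 < delta ->
  shock_solution rho r gamma lambda10 fhat f ->
  (\forall l \near 0^'+,
     0 < b l /\ liquid_hjb rho r mu sigma gamma L f l (b l)) ->
  b l @[l --> 0^'+] --> fhat ->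
  exists C : R, \forall l \near 0^'+,
    `|b l - (fhat + l * ((xihat - fhat) * (1 - gamma) / delta))| <= C * l ^+ 2.
Proof.
move=> fhat delta xihat sigma0 L01 gamma0 gamma1 ph01 delta0 hf hb hb0.
have g1 : 0 < 1 - gamma by rewrite subr_gt0.
have a0 : 0 < (1 - gamma) / delta by rewrite divr_gt0.
have fhat0 : 0 < fhat by rewrite powR_gt0.
have [C C0 xiC] := @shock_xi_linear_bound _ _ _ _ _ _ _ _ gamma0 L01 hf _ ph01.
set q := gamma / (gamma - 1).
have [K K0 qK] := @powR_taylor2 R fhat q fhat0.
set k := (1 - gamma) * sigma ^+ 2.
have k0 : 0 < k by rewrite mulr_gt0// exprn_gt0.
have fq1 : fhat `^ (q - 1) = delta / (1 - gamma).
  by rewrite /fhat /merton_fhat powR_dual_exponent// invf_div.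
(* This is the Merton equation [(1 - gamma) fhat^q = delta fhat], the case [l = 0]. *)
have fq : fhat `^ q = fhat * (delta / (1 - gamma)).
  rewrite -fq1 -[in LHS](subrKC 1 q) powRD; last first.
    by rewrite (gt_eqF fhat0) implybT.
  by rewrite powRr1// ltW.
pose e l := b l - fhat.
have e0 : e l @[l --> 0^'+] --> 0.
  have h := cvgB hb0 (cvg_cst fhat); rewrite subrr in h.
  exact: h.
(* [A] comes from the residual bound with [b l >= fhat / 2], [G] from the Taylor remainder, and the
   1 in [B] from the cross term [l * e l]. *)
pose A := `|gamma| * (C ^+ 2 / (k * fhat)).
have A0 : 0 <= A by rewrite mulr_ge0// divr_ge0 ?sqr_ge0// mulr_ge0// ltW.
pose G := (1 - gamma) * K.
have G0 : 0 <= G by rewrite mulr_ge0// ltW.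
pose B := 1 + A + G.
have B0 : 0 <= B by rewrite !addr_ge0.
have [||C' C'P] := @implicit_expansion R e (delta / (1 - gamma))
    (xihat - fhat) B _ B0 e0.
- by rewrite divr_gt0.
- near=> l.
  have l0 : 0 < l by near: l; exact: nbhs_right_gt.
  have [bl0 hjb] : 0 < b l /\ liquid_hjb rho r mu sigma gamma L f l (b l).
    by near: l.
  have bhalf : fhat / 2 <= b l.
    near: l; move/cvgr_ge : hb0; apply.
    by rewrite ltr_pdivrMr// ltr_pMr// ltr1n.
  have taylor : `|b l `^ q - fhat `^ q - q * fhat `^ (q - 1) * e l|
      <= K * e l ^+ 2.
    by near: l; exact: hb0 _ qK.
  have := @liquid_hjb_residual _ rho r mu sigma gamma L C l (b l) f
    sigma0 gamma0 gamma1 ph01 l0 bl0 xiC hjb.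
  rewrite -/q -/delta -/xihat -/k => res.
  have resA : `|(1 - gamma) * b l `^ q - delta * b l + l * (xihat - b l)|
      <= A * l ^+ 2.
    apply: (le_trans res); rewrite /A -[leRHS]mulrA ler_wpM2l//.
    rewrite [leRHS]mulrAC [X in _ <= X / _]mulrC ler_wpM2l ?mulr_ge0 ?sqr_ge0//.
    rewrite lef_pV2 ?posrE ?mulr_gt0//.
    by have := ler_wpM2l (ltW k0) bhalf; lra.
  rewrite (_ : l * (xihat - fhat) - delta / (1 - gamma) * e l =
    ((1 - gamma) * b l `^ q - delta * b l + l * (xihat - b l)) + l * e l
    - (1 - gamma) * (b l `^ q - fhat `^ q - q * fhat `^ (q - 1) * e l));
    last first.
    rewrite fq fq1 /e /q; field.
    by rewrite gt_eqF// lt_eqF ?subr_lt0.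
  rewrite (le_trans (ler_normB _ _))//.
  rewrite (le_trans (lerD (ler_normD _ _) (lexx _)))//.
  rewrite !normrM (gtr0_norm g1) (gtr0_norm l0).
  have lin0 : 0 <= l * `|e l| by rewrite mulr_ge0// ltW.
  have := ler_wpM2l (ltW g1) taylor; rewrite mulrA -/G /B.
  move: resA (sqr_ge0 l) (sqr_ge0 (e l)) lin0.
  set X := l ^+ 2; set Y := e l ^+ 2; set Z := l * `|e l|.
  move=> resA X0 Y0 Z0 taylorG.
  (* [A] is needed only on [X] and [G] only on [Y], while [B] multiplies [X + Y + Z]; the surplus
     products are nonnegative. *)
  have AYZ : 0 <= A * (Y + Z) by rewrite mulr_ge0// addr_ge0.
  have GXZ : 0 <= G * (X + Z) by rewrite mulr_ge0// addr_ge0.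
  lra.
exists C'; apply: filterS C'P => l; congr (`|_| <= _).
by rewrite /e; field; rewrite !gt_eqF.
Unshelve. all: by end_near. Qed.

Theorem mainTheorem7 (R : realType)
  (rho r mu sigma gamma lambda10 L : R) (f b Theta : R -> R)
  (hrho : 0 < rho) (hr : 0 <= r) (hsigma : 0 < sigma)
  (hlambda10 : 0 < lambda10) (hL : 0 <= L < 1)
  (hgamma : gamma < 0 \/ 0 < gamma < 1)
  (hpihat : 0 < merton_pihat r mu sigma gamma < 1)
  (hdelta : 0 < merton_delta rho r mu sigma gamma)
  (hf : shock_solution rho r gamma lambda10
          (merton_fhat rho r mu sigma gamma) f)
  (hb : \forall l \near 0^'+,
          0 < b l /\ liquid_hjb rho r mu sigma gamma L f l (b l))
  (hb0 : b l @[l --> 0^'+] --> merton_fhat rho r mu sigma gamma)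
  (hTheta : \forall l \near 0^'+,
     is_efficiency_loss gamma (merton_fhat rho r mu sigma gamma)
       (b l) (Theta l)) :
  let fhat := merton_fhat rho r mu sigma gamma in
  let delta := merton_delta rho r mu sigma gamma in
  let xihat := shock_xi gamma L f (merton_pihat r mu sigma gamma) in
  let b1 := (xihat - fhat) * (1 - gamma) / delta in
  let Theta1 := - (b1 / (gamma * fhat)) in
  [/\ b = (fun l : R => fhat + l * b1) +O_ (0^'+) (fun l : R => l ^+ 2),
      Theta = (fun l : R => l * Theta1) +O_ (0^'+) (fun l : R => l ^+ 2)
    & Theta1 = (xihat / fhat - 1) * ((gamma - 1) / (gamma * delta))].
Proof.
move=> fhat delta xihat b1 Theta1.
have [gamma0 gamma1] : gamma != 0 /\ gamma < 1.
  case: hgamma => [gN|/andP[gP g1]]; last by rewrite gt_eqF.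
  by rewrite lt_eqF// (lt_trans gN).
have fhat0 : 0 < fhat by rewrite powR_gt0// divr_gt0// subr_gt0.
have [C bC] := @liquid_value_expansion _ _ _ _ _ _ _ _ _ _
  hsigma hL gamma0 gamma1 hpihat hdelta hf hb hb0.
rewrite -/fhat -/delta -/xihat -/b1 in bC.
split; first exact: bigO_sqr_at_right bC; last first.
  rewrite /Theta1 /b1; field.
  by rewrite gamma0 !gt_eqF.
have [K K0 gK] := @powR_taylor2 R 1 gamma^-1 ltr01.
have bf1 : b l / fhat @[l --> 0^'+] --> (1 : R).
  have h := cvgM hb0 (cvg_cst fhat^-1); rewrite divff ?gt_eqF// in h.
  exact: h.
(* For [l < 1] the expansion of [b] gives [|b l - fhat| <= D l]; [C] carries no sign, hence its
   absolute value. *)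
pose D := `|b1| + `|C|.
apply: (@bigO_sqr_at_right _ _ _ (K * (D / fhat) ^+ 2 + C / `|gamma * fhat|)).
near=> l.
have l0 : 0 < l by near: l; exact: nbhs_right_gt.
have l1 : l < 1 by near: l; exact: nbhs_right_lt.
have bCl : `|b l - (fhat + l * b1)| <= C * l ^+ 2 by near: l.
have -> : Theta l = 1 - (b l / fhat) `^ gamma^-1.
  by apply: efficiency_lossE => //; near: l.
have taylor : `|(b l / fhat) `^ gamma^-1 - 1 `^ gamma^-1
    - gamma^-1 * 1 `^ (gamma^-1 - 1) * (b l / fhat - 1)|
    <= K * (b l / fhat - 1) ^+ 2.
  by near: l; exact: bf1 _ gK.
rewrite !powR1 mulr1 in taylor.
have eD : `|b l / fhat - 1| <= D / fhat * l.
  rewrite -[X in _ - X](divff (lt0r_neq0 fhat0)) -mulrBl normf_div.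
  rewrite (gtr0_norm fhat0) mulrAC ler_wpM2r ?invr_ge0 ?(ltW fhat0)//.
  have -> : b l - fhat = (b l - (fhat + l * b1)) + l * b1 by ring.
  rewrite (le_trans (ler_normD _ _))// normrM (gtr0_norm l0) /D mulrDl addrC.
  apply: lerD; first by rewrite mulrC.
  rewrite (le_trans bCl)// (le_trans (ler_norm _))//.
  by rewrite normrM ler_wpM2l// ger0_norm ?sqr_ge0// expr2 ler_piMl// ltW.
(* The error splits into the Taylor remainder of the power at 1 and the error in [b] divided by
   [gamma fhat]. *)
have -> : 1 - (b l / fhat) `^ gamma^-1 - l * Theta1 =
  - ((b l / fhat) `^ gamma^-1 - 1 - gamma^-1 * (b l / fhat - 1))
  - (b l - (fhat + l * b1)) / (gamma * fhat).
  by rewrite /Theta1; field; rewrite gamma0 gt_eqF.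
rewrite (le_trans (ler_normB _ _))// normrN [leRHS]mulrDl lerD//.
  rewrite (le_trans taylor)// -mulrA ler_wpM2l// -exprMn.
  by rewrite -(real_normK (num_real (_ - 1))) lerXn2r// nnegrE (le_trans _ eD).
by rewrite normf_div mulrAC ler_wpM2r// invr_ge0.
Unshelve. all: by end_near. Qed.
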